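(* (i) For every $\mathbf t\in\mathbb R^K$ and $L\ge0$, \[ \mathrm P_{\boldsymbol\Delta/\sigma_0=\mathbf t}\big(|\hat\tau_{\rm PT}-\tau|\le L(1+\|\boldsymbol\gamma\|_1)^{-1/2}\sigma_0\big)=\int_{\mathbb R^K}\Big[\Phi\Big(L-\frac{\langle\boldsymbol\gamma,\mathbf t-\mathbf u'\rangle}{\sqrt{1+\|\boldsymbol\gamma\|_1}}\Big)-\Phi\Big(-L-\frac{\langle\boldsymbol\gamma,\mathbf t-\mathbf u'\rangle}{\sqrt{1+\|\boldsymbol\gamma\|_1}}\Big)\Big]\phi_{\mathbf t,V}(\mathbf u)\,d\mathbf u, \] where for $\mathbf u\in\mathbb R^K$, $u_j'=u_j\,\mathbf 1\big(|u_j|>(1+\gamma_j^{-1})^{1/2}c_{\alpha/2}\big)$ for $j=1,\dots,K$. (ii) Let \[ \hat L_{\rm PT}=\inf\Big\{L\ge0:\inf_{\boldsymbol\Delta:|\Delta_j/\sigma_0|\le b_j\forall j}\mathrm P_{\boldsymbol\Delta}\big(|\hat\tau_{\rm PT}-\tau|\le L(1+\|\boldsymbol\gamma\|_1)^{-1/2}\sigma_0\big)\ge1-\zeta\Big\}. \] Then $\hat L_{\rm PT}$ is the solution in $L$ of \[ \inf_{\boldsymbol\Delta:|\Delta_j/\sigma_0|\le b_j\forall j}\mathrm P_{\boldsymbol\Delta}\big(|\hat\tau_{\rm PT}-\tau|\le L(1+\|\boldsymbol\gamma\|_1)^{-1/2}\sigma_0\big)=1-\zeta. \] The resulting interval $[\hat\tau_{\rm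 PT}\pm\hat L_{\rm PT}(1+\|\boldsymbol\gamma\|_1)^{-1/2}\sigma_0]$ is the shortest symmetric centered interval with data-independent half-length achieving uniform coverage $1-\zeta$.
   Context: Let $K\ge1$, $\tau\in\mathbb R$ unknown and $\boldsymbol\Delta=(\Delta_1,\dots,\Delta_K)\in\mathbb R^K$ unknown biases. We observe independent random variables $\hat\tau_0\sim N(\tau,\sigma_0^2)$ and $\hat\tau_j\sim N(\tau+\Delta_j,\sigma_j^2)$ for $j=1,\dots,K$, with $\sigma_0,\dots,\sigma_K>0$ known. Define $\gamma_j=\sigma_0^2/\sigma_j^2$, $\boldsymbol\gamma=(\gamma_1,\dots,\gamma_K)$ and $\|\boldsymbol\gamma\|_1=\sum_j\gamma_j$. $\langle\cdot,\cdot\rangle$ is the Euclidean inner product. Write $\Phi$ for the standard normal CDF, and $c_a=\Phi^{-1}(1-a)$ for $a\in(0,1)$. Fix $\alpha,\zeta\in(0,1)$ and $\mathbf b\in[0,\infty)^K$. Let $\mathcal A_j=\{|\hat\tau_j-\hat\tau_0|\le(1+\gamma_j^{-1})^{1/2}\sigma_0c_{\alpha/2}\}$. The pretest estimator is \[ \hat\tau_{\rm PT}=\hat\tau_0+\sum_{j=1}^K\frac{\gamma_j}{1+\|\boldsymbol\gamma\|_1}(\hat\tau_j-\hat\tau_0)\mathbf 1(\mathcal A_j). \] $V$ is the $K\times K$ matrix with $V_{ij}=1+\gamma_i^{-1}\mathbf 1(i=j)$, and $\phi_{\mathbf t,V}$ is the density of $N(\mathbf t,V)$. $\mathrm P_{\boldsymbol\Delta/\sigma_0=\mathbf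 t}$ means probability under $\boldsymbol\Delta=\sigma_0\mathbf t$. *)

(* Defs.v *)
From HB Require Import structures.
From mathcomp Require Import all_boot all_order all_algebra.
From mathcomp Require Import all_classical all_reals all_analysis.
From mathcomp Require Import normal_distribution.
Set Implicit Arguments. Unset Strict Implicit. Unset Printing Implicit Defensive.
Import Order.TTheory GRing.Theory Num.Theory.
Local Open Scope classical_set_scope.
Local Open Scope ring_scope.

Section Defs.
Context {R : realType}.

Definition Phi (x : R) : R := fine (normal_prob 0 1 `]-oo, x]).

Definition crit (a : R) : R := inf [set x : R | 1 - a <= Phi x].

Fixpoint iint (n : nat) (f : seq R -> \bar R) : \bar R :=
  match n with
  | 0 => f [::]
  | n'.+1 => (\int[@lebesgue_measure R]_x iint n' (fun s => f (x :: s)))%E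
  end.

Definition intRK (K : nat) (f : 'rV[R]_K -> \bar R) : \bar R :=
  iint K (fun s => f (\row_(j < K) nth 0 s j)).

Variable K : nat.

Definition gam (s0 : R) (s : 'I_K -> R) (j : 'I_K) : R := s0 ^+ 2 / s j ^+ 2.
Definition gnorm (s0 : R) (s : 'I_K -> R) : R := \sum_(j < K) gam s0 s j.

(* pretest estimator, x0 = tau_hat_0, x j = tau_hat_j *)
Definition tauPT (s0 : R) (s : 'I_K -> R) (alpha : R) (x0 : R) (x : 'I_K -> R) : R :=
  x0 + \sum_(j < K) gam s0 s j / (1 + gnorm s0 s) * (x j - x0) *
         ((`|x j - x0| <= Num.sqrt (1 + (gam s0 s j)^-1) * s0 * crit (alpha / 2))%R)%:R.

(* P_Delta(|tauPT - tau| <= L (1+||gamma||_1)^{-1/2} sigma_0), under independent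
   tau_hat_0 ~ N(tau, s0^2), tau_hat_j ~ N(tau + Delta_j, s_j^2) *)
Definition PT_prob (s0 : R) (s : 'I_K -> R) (alpha tau : R) (Delta : 'I_K -> R)
  (L : R) : \bar R :=
  (\int[@lebesgue_measure R]_x0
     intRK (fun x : 'rV[R]_K =>
       (((`|tauPT s0 s alpha x0 (fun j => x 0 j) - tau|
            <= L * (Num.sqrt (1 + gnorm s0 s))^-1 * s0)%R)%:R
        * normal_pdf tau s0 x0
        * \prod_(j < K) normal_pdf (tau + Delta j) (s j) (x 0 j))%:E))%E.

Definition Vmat (s0 : R) (s : 'I_K -> R) : 'M[R]_K :=
  \matrix_(i, j) (1 + (gam s0 s i)^-1 * ((i == j)%R)%:R).

Definition mvn_pdf (t : 'rV[R]_K) (V : 'M[R]_K) (u : 'rV[R]_K) : R :=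
  (Num.sqrt (pi *+ 2)) ^- K * (Num.sqrt (\det V))^-1 *
  expR (- (((u - t) *m invmx V *m (u - t)^T) 0 0) / 2).

Definition rhs_i (s0 : R) (s : 'I_K -> R) (alpha : R) (t : 'I_K -> R) (L : R)
  : \bar R :=
  intRK (fun u : 'rV[R]_K =>
    let u' := fun j => u 0 j *
        ((Num.sqrt (1 + (gam s0 s j)^-1) * crit (alpha / 2) < `|u 0 j|)%R)%:R in
    let ip := (\sum_(j < K) gam s0 s j * (t j - u' j))
                / Num.sqrt (1 + gnorm s0 s) in
    ((Phi (L - ip) - Phi (- L - ip))
       * mvn_pdf (\row_j t j) (Vmat s0 s) u)%:E).

Definition h_cov (s0 : R) (s : 'I_K -> R) (alpha tau : R) (b : 'I_K -> R) (L : R)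
  : \bar R :=
  ereal_inf [set PT_prob s0 s alpha tau Delta L | Delta in
             [set Delta : 'I_K -> R | forall j, `|Delta j / s0| <= b j]].

Definition Lhat (s0 : R) (s : 'I_K -> R) (alpha tau : R) (b : 'I_K -> R) (zeta : R)
  : R :=
  inf [set L : R | 0 <= L /\ ((1 - zeta)%:E <= h_cov s0 s alpha tau b L)%E].

End Defs.

(* Main.v *)
Require Import Defs.
From HB Require Import structures.
From mathcomp Require Import all_boot all_order all_algebra.
From mathcomp Require Import all_classical all_reals all_analysis.
From mathcomp Require Import measurable_realfun normal_distribution.
From mathcomp Require Import ring lra.
Set Implicit Arguments. Unset Strict Implicit. Unset Printing Implicit Defensive.
Import Order.TTheory GRing.Theory Num.Theory.
Local Open Scope classical_set_scope.
Local Open Scope ring_scope.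

(* With [x_j = x0 + s0 u_j] the error of the pretest estimator is affine in [x0]
   once [u] is fixed.  Completing the square in [x0], the joint density becomes
   the N(t, V) density of [u] times a normal density in [x0], so integrating
   [x0] out first leaves a difference of two values of [Phi]: this is (i).
   For (ii), formula (i) shows that, uniformly over the box of biases, the
   coverage is Lipschitz in [L] (the N(t, V) density has mass one) and increases
   at a definite rate (that density is bounded below on [-1, 1]^K); together with
   tightness these properties pass to the infimum. *)

(** The coverage integrates [x0] last, while (i) needs it integrated first. As integrals over R^K
    are iterated coordinate by coordinate, [x0] has to pass over K of them, and each exchange needs
    measurability in all the remaining parameters. In (ii), continuity and strict monotonicity of
    each single coverage function would not survive an infimum over infinitely many biases.
    Quantitative forms do survive: a Lipschitz constant free of the bias makes the infimum over
    admissible [L] solve the equation, and an increment [e] common to the whole box makes that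
    solution unique. That the level is reached at all comes from independence rather than from (i):
    all K+1 observations are close to their means with high probability. Since [rhs_i] does not
    involve [tau], the half-length is the same for every [tau]. *)

(** * Tonelli and affine substitution for iterated integrals *)

Section IteratedIntegral.
Context {R : realType}.
Local Open Scope ereal_scope.
Local Notation mu := (@lebesgue_measure R).
Implicit Types f g : seq R -> \bar R.

(* Measurability of [f] as a function of [n] real variables, tested against
   every measurable family of coordinates so that no product sigma-algebra on
   sequences is needed. *)
Definition smeasurable (n : nat) f : Prop :=
  forall d (T : measurableType d) (g : nat -> T -> R),
    (forall i, measurable_fun [set: T] (g i)) ->
    measurable_fun [set: T] (fun x => f (mkseq (fun i => g i x) n)).

Lemma mkseqS_cons (T : Type) (g : nat -> T) n :
  mkseq g n.+1 = g 0%N :: mkseq (g \o succn) n.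
Proof. by rewrite /mkseq /= -[1%N]addn0 iotaDl -map_comp. Qed.

Lemma smeasurable_cons n f d (T : measurableType d) (h : T -> R)
    (g : nat -> T -> R) : smeasurable n.+1 f -> measurable_fun [set: T] h ->
  (forall i, measurable_fun [set: T] (g i)) ->
  measurable_fun [set: T] (fun x => f (h x :: mkseq (fun i => g i x) n)).
Proof.
move=> mf mh mg.
rewrite (_ : (fun x => _) = fun x => f (mkseq (fun i =>
  (fun i => if i is j.+1 then g j else h) i x) n.+1)).
  by apply: mf => -[|i].
by apply/funext => x; rewrite mkseqS_cons.
Qed.

Lemma smeasurable_consl n f (x : R) :
  smeasurable n.+1 f -> smeasurable n (fun s => f (x :: s)).
Proof. by move=> mf d T g mg; exact: (smeasurable_cons (h := cst x) mf). Qed.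

(** Freezing the second coordinate is what the induction in [iint_tonelli] needs: the outer variable
    has just passed over it. *)
Lemma smeasurable_swap n f : smeasurable n.+2 f ->
  forall x, smeasurable n.+1 (fun s => f (head 0 s :: x :: behead s)%R).
Proof.
move=> mf x d T g mg.
rewrite (_ : (fun y => _) = fun y => f (mkseq (fun i =>
  (fun i => if i is j.+1 then if j is k.+1 then g k.+1 else cst x else g 0%N)
   i y) n.+2)).
  by apply: mf => -[|[|i]].
by apply/funext => y; rewrite !mkseqS_cons.
Qed.

Lemma iint_ge0 n f : (forall s, 0 <= f s) -> 0 <= iint n f.
Proof.
elim: n f => [|n IH] f f0 /=; first exact: f0.
by apply: integral_ge0 => x _; exact: IH.
Qed.

(** The prefix of [m] parameters makes the induction on [n] work: the next integration variable
    joins the prefix as coordinate [m], over the product space [T * R], and Tonelli removes it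
    again. *)
Lemma measurable_iint n m f d (T : measurableType d) (h : nat -> T -> R) :
  smeasurable (m + n) f -> (forall s, 0 <= f s) ->
  (forall i, measurable_fun [set: T] (h i)) ->
  measurable_fun [set: T]
    (fun y => iint n (fun s => f (mkseq (fun i => h i y) m ++ s))).
Proof.
elim: n m f d T h => [|n IH] m f d T h mf f0 mh /=.
  under eq_fun do rewrite cats0.
  by rewrite addn0 in mf; exact: mf.
apply: (measurable_fun_fubini_tonelli_F (fun z : T * measurableTypeR R =>
  iint n (fun s => f (mkseq (fun i => h i z.1) m ++ z.2 :: s)))) => /=; last first.
  by move=> z; apply: iint_ge0.
pose h' i (z : T * measurableTypeR R) : R :=
  if (i < m)%N then h i z.1 else z.2.
rewrite (_ : (fun z => _) = fun z =>
    iint n (fun s => f (mkseq (fun i => h' i z) m.+1 ++ s))).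
  apply: IH; rewrite ?addSnnS // => i; rewrite /h'.
  by case: (i < m)%N => //; exact: measurableT_comp.
apply/funext => z; congr (iint n _); apply/funext => s; congr f.
rewrite mkseqS -cat_rcons /h' ltnn; congr (rcons _ _ ++ _).
by apply/eq_in_map => i; rewrite mem_iota add0n => /andP[_ ->].
Qed.

Lemma smeasurable_iint n f : smeasurable n.+1 f -> (forall s, 0 <= f s) ->
  measurable_fun [set: R] (fun x => iint n (fun s => f (x :: s))).
Proof.
by move=> mf f0; apply: (measurable_iint (m := 1) (h := fun=> id) mf f0).
Qed.

Lemma eq_iint n f g : (forall s, size s = n -> f s = g s) ->
  iint n f = iint n g.
Proof.
elim: n f g => [|n IH] f g fg /=; first exact: fg.
by apply: eq_integral => x _; apply: IH => s sn; apply: fg; rewrite /= sn.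
Qed.

Lemma le_iint n f g : smeasurable n f -> smeasurable n g ->
  (forall s, 0 <= f s) -> (forall s, 0 <= g s) ->
  (forall s, size s = n -> f s <= g s) -> iint n f <= iint n g.
Proof.
elim: n f g => [|n IH] f g mf mg f0 g0 fg /=; first exact: fg.
apply: ge0_le_integral => //.
- by move=> x _; exact: iint_ge0.
- exact: smeasurable_iint.
- exact: smeasurable_iint.
- move=> x _; apply: IH => //; try exact: smeasurable_consl.
  by move=> s sn; apply: fg; rewrite /= sn.
Qed.

Lemma iintD n f g : smeasurable n f -> smeasurable n g ->
  (forall s, 0 <= f s) -> (forall s, 0 <= g s) ->
  iint n (fun s => f s + g s) = iint n f + iint n g.
Proof.
elim: n f g => [|n IH] f g mf mg f0 g0 //=.
rewrite -ge0_integralD //.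
- by apply: eq_integral => x _; apply: IH => //; exact: smeasurable_consl.
- by move=> x _; exact: iint_ge0.
- exact: smeasurable_iint.
- by move=> x _; exact: iint_ge0.
- exact: smeasurable_iint.
Qed.

Lemma iintZl n f (k : R) : smeasurable n f -> (forall s, 0 <= f s) ->
  (0 <= k)%R -> iint n (fun s => k%:E * f s) = k%:E * iint n f.
Proof.
elim: n f => [|n IH] f mf f0 k0 //=.
rewrite -ge0_integralZl_EFin //.
- by apply: eq_integral => x _; apply: IH => //; exact: smeasurable_consl.
- by move=> x _; exact: iint_ge0.
- exact: smeasurable_iint.
Qed.

(** One adjacent exchange moves the outer variable past the first coordinate; the induction
    hypothesis, with that coordinate frozen, carries it past the others. *)
Lemma iint_tonelli n f : smeasurable n.+1 f -> (forall s, 0 <= f s) ->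
  \int[mu]_x iint n (fun s => f (x :: s)) =
  iint n (fun s => \int[mu]_x f (x :: s)).
Proof.
elim: n f => [|n IH] f mf f0 //=.
transitivity (\int[mu]_y \int[mu]_x iint n (fun s => f [:: x, y & s])).
  apply: (fubini_tonelli (m1 := mu) (m2 := mu)
    (fun z : measurableTypeR R * measurableTypeR R =>
       iint n (fun s => f [:: z.1, z.2 & s]))) => /=; last first.
    by move=> z; exact: iint_ge0.
  apply: (measurable_iint (m := 2) (h := fun i => if i is 0%N then fst else snd) mf f0).
  by move=> -[|i].
apply: eq_integral => y _.
rewrite (IH (fun s => f (head 0%R s :: y :: behead s))) //.
exact: smeasurable_swap.
Qed.

(** [c] times the image of Lebesgue measure under [x |-> a + c * x] gives half-open intervals their
    length, so by uniqueness it is Lebesgue measure. *)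
Lemma ge0_integral_affine (a c : R) (f : R -> \bar R) : (0 < c)%R ->
  measurable_fun [set: R] f -> (forall x, 0 <= f x) ->
  \int[mu]_x f x = c%:E * \int[mu]_x f (a + c * x)%R.
Proof.
move=> c0 mf f0.
have mphi : measurable_fun [set: measurableTypeR R]
    ((fun x => a + c * x)%R : _ -> measurableTypeR R).
  by apply: measurable_funD => //; exact: measurable_funM.
have c0' : (0 <= c)%R by exact: ltW.
rewrite (eq_measure_integral (mscale (NngNum c0') (pushforward mu
  ((fun x => a + c * x)%R : measurableTypeR R -> measurableTypeR R)))) //=; last first.
  move=> A mA _.
  apply: lebesgue_measure_unique => // X /ocitvP[->|[[u v]/= uv ->]].
    by rewrite !measure0.
  rewrite /mscale /= /pushforward /=.
  rewrite (_ : _ @^-1` _ = `](u - a) / c, (v - a) / c]%classic)%R; last first.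
    apply/seteqP; split => x /=; rewrite !in_itv /= ltr_pdivrMr // ler_pdivlMr //;
      by rewrite ltrBlDl lerBrDl (mulrC c).
  rewrite !lebesgue_measure_itv /= !lte_fin ltr_pM2r ?invr_gt0 // ltrD2r uv.
  by rewrite -!EFinB -EFinM; congr EFin; field; rewrite gt_eqF.
rewrite ge0_integral_mscale //.
by rewrite ge0_integral_pushforward.
Qed.

Lemma iint_affine n f (a c : R) : (0 < c)%R -> smeasurable n f ->
  (forall s, 0 <= f s) ->
  iint n f = (c ^+ n)%:E * iint n (fun s => f [seq a + c * x | x <- s]%R).
Proof.
move=> c0; elim: n f => [|n IH] f mf f0 /=; first by rewrite mul1e.
rewrite (ge0_integral_affine a c0); last 2 first.
- exact: smeasurable_iint.
- by move=> x; exact: iint_ge0.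
rewrite exprS EFinM -muleA; congr (_ * _).
rewrite -ge0_integralZl_EFin //; last 3 first.
- by move=> x _; exact: iint_ge0.
- apply: (smeasurable_iint (f := fun s => f [seq a + c * x | x <- s]%R)) => //.
  move=> d T g mg; under eq_fun do rewrite -map_comp.
  by apply: (mf _ _ (fun i x => a + c * g i x)%R) => i; apply: measurable_funD => //;
    apply: measurable_funM.
- by rewrite exprn_ge0 // ltW.
by apply: eq_integral => x _; rewrite IH //; exact: smeasurable_consl.
Qed.

Lemma smeasurable_EFin n (f : seq R -> R) :
  (forall d (T : measurableType d) (g : nat -> T -> R),
    (forall i, measurable_fun [set: T] (g i)) ->
    measurable_fun [set: T] (fun x => f (mkseq (fun i => g i x) n))) ->
  smeasurable n (fun s => (f s)%:E).
Proof. by move=> mf d T g mg; apply/measurable_EFinP; exact: mf. Qed.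

Lemma smeasurable_nth_prod n (h : nat -> R -> R) :
  (forall i, measurable_fun [set: R] (h i)) ->
  smeasurable n (fun s => (\prod_(i < n) h i (nth 0 s i))%:E)%R.
Proof.
move=> mh; apply: smeasurable_EFin => d T g mg.
apply: measurable_prod => i _.
under eq_fun do rewrite nth_mkseq //.
exact: measurableT_comp.
Qed.

Lemma iint_prod n (h : nat -> R -> R) :
  (forall i, measurable_fun [set: R] (h i)) -> (forall i x, (0 <= h i x)%R) ->
  iint n (fun s => (\prod_(i < n) h i (nth 0 s i))%:E)%R =
  \prod_(i < n) \int[mu]_x (h i x)%:E.
Proof.
elim: n h => [|n IH] h mh h0 /=; first by rewrite !big_ord0.
rewrite big_ord_recl /= -(IH (fun i => h i.+1)) //.
rewrite muleC -ge0_integralZl //; last 3 first.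
- by apply/measurable_EFinP; exact: mh.
- by move=> x _; rewrite lee_fin h0.
- by apply: iint_ge0 => s; rewrite lee_fin prodr_ge0.
apply: eq_integral => x _; rewrite muleC -iintZl //.
- by apply: eq_iint => s _; rewrite big_ord_recl /= EFinM.
- exact: (@smeasurable_nth_prod n (fun i => h i.+1)).
- by move=> s; rewrite lee_fin prodr_ge0.
Qed.

End IteratedIntegral.

(** * The one-dimensional normal law *)

Section NormalDensity.
Context {R : realType}.
Local Notation mu := (@lebesgue_measure R).
Implicit Types m x : R.

Lemma normal_pdf_std m (sd : R) x : 0 < sd ->
  normal_pdf m sd x =
  (sd * Num.sqrt (pi *+ 2))^-1 * expR (- ((x - m) / sd) ^+ 2 / 2).
Proof.
move=> sd0; rewrite normal_pdfE ?gt_eqF // /normal_peak /normal_fun.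
congr (_^-1 * expR _).
- by rewrite -mulrnAr sqrtrM ?sqr_ge0 // sqrtr_sqr gtr0_norm.
- by field; rewrite gt_eqF.
Qed.

Lemma measurable_normal_pdf_comp d (T : measurableType d) (f : T -> R) m sd :
  measurable_fun [set: T] f ->
  measurable_fun [set: T] (fun y => normal_pdf m sd (f y)).
Proof. exact: (measurableT_comp (measurable_normal_pdf m sd)). Qed.

Lemma normal_prob_itvcc (a b : R) : a <= b ->
  normal_prob 0 1 `[a, b]%classic = (Phi b - Phi a)%:E.
Proof.
move=> ab.
have mpdf A : measurable_fun A (fun x : R => (normal_pdf 0 1 x)%:E).
  by apply: measurable_funTS; apply/measurable_EFinP; exact: measurable_normal_pdf.
have -> : normal_prob 0 1 `[a, b]%classic = normal_prob 0 1 `]a, b]%classic.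
  by rewrite /normal_prob -integral_itv_obnd_cbnd.
have fin c : normal_prob 0 1 `]-oo, c]%classic = (Phi c)%:E.
  by rewrite /Phi fineK // fin_num_measure.
have E : (normal_prob 0 1 `]-oo, b]%classic =
    normal_prob 0 1 `]-oo, a]%classic + normal_prob 0 1 `]a, b]%classic)%E.
  rewrite -measureU //.
    congr (normal_prob _ _ _); apply/seteqP; split => x /=; rewrite !in_itv /=.
      by move=> xb; case: (leP x a) => xa; [left|right; rewrite xb].
    by case=> [xa|/andP[]//]; exact: le_trans ab.
  apply/seteqP; split => x //=; rewrite !in_itv /= => -[xa /andP[ax _]].
  by move: (le_lt_trans xa ax); rewrite ltxx.
have finI : (normal_prob 0 1 `]a, b]%classic \is a fin_num)%E.
  by rewrite fin_num_measure.
move: E; rewrite !fin -(fineK finI) -EFinD => -[->].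
by congr EFin; rewrite addrAC subrr add0r.
Qed.

Lemma Phi_lipschitz (a b : R) : a <= b ->
  0 <= Phi b - Phi a <= normal_peak 1 * (b - a).
Proof.
move=> ab; rewrite -!lee_fin -normal_prob_itvcc // measure_ge0 /=.
apply: (@le_trans _ _ (\int[mu]_(x in `[a, b]) (normal_peak 1)%:E)%E).
  apply: ge0_le_integral => //.
  - by move=> x _; rewrite lee_fin normal_pdf_ge0.
  - by apply: measurable_funTS; apply/measurable_EFinP; exact: measurable_normal_pdf.
  - by move=> x _; rewrite lee_fin normal_pdf_ub // oner_neq0.
rewrite integral_cst //= lebesgue_measure_itv /= lte_fin EFinM.
have [|ba] := ltP a b; first by rewrite EFinB.
by rewrite (_ : b = a) ?subrr //; apply/eqP; rewrite eq_le ab ba.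
Qed.

(** On [[-M, M]] the standard normal density is smallest at the endpoints. *)
Lemma Phi_increase (M a b : R) : - M <= a -> a <= b -> b <= M ->
  normal_pdf 0 1 M * (b - a) <= Phi b - Phi a.
Proof.
move=> Ma ab bM; rewrite -lee_fin -normal_prob_itvcc //.
apply: (@le_trans _ _ (\int[mu]_(x in `[a, b]) (normal_pdf 0 1 M)%:E)%E).
  rewrite integral_cst //= lebesgue_measure_itv /= lte_fin EFinM.
  have [|ba] := ltP a b; first by rewrite EFinB.
  by rewrite (_ : b = a) ?subrr //; apply/eqP; rewrite eq_le ab ba.
apply: ge0_le_integral => //.
- by move=> x _; rewrite lee_fin normal_pdf_ge0.
- by apply: measurable_funTS; apply/measurable_EFinP; exact: measurable_normal_pdf.
move=> x /=; rewrite in_itv /= => /andP[ax xb].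
rewrite lee_fin !normal_pdf_std // ler_pM2l; last first.
  by rewrite invr_gt0 mul1r sqrtr_gt0 mulrn_wgt0 // pi_gt0.
rewrite ler_expR !subr0 !divr1 ler_pM2r ?invr_gt0 // lerN2.
rewrite -subr_ge0 subr_sqr mulr_ge0 //; lra.
Qed.

(** Continuity from below along the windows [[-n, n]], which exhaust the line. *)
Lemma Phi_window_cvg1 (p : R) : p < 1 ->
  exists2 M : R, 0 <= M & p < Phi M - Phi (- M).
Proof.
move=> p1.
pose F (n : nat) : set R := `[- n%:R, n%:R]%classic.
have ndF : nondecreasing_seq F.
  move=> m n mn; apply/subsetPset => x /=; rewrite /F /= !in_itv /= => /andP[xl xr].
  have : (m%:R : R) <= n%:R by rewrite ler_nat.
  by lra.
have cF : normal_prob 0 1 (F n) @[n --> \oo] --> normal_prob 0 1 (\bigcup_n F n).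
  apply: nondecreasing_cvg_mu => // [n|]; first exact: measurable_itv.
  by apply: bigcup_measurable => n _; exact: measurable_itv.
have UF : \bigcup_n F n = setT.
  apply/seteqP; split => x // _; exists (Num.truncn `|x|).+1 => //=.
  rewrite /F /= in_itv /= -ler_norml.
  by apply/ltW; rewrite Num.Theory.truncnS_gt.
move: cF; rewrite UF probability_setT => cF.
have /cF : nbhs (1%E : \bar R) [set y | (p%:E < y)%E].
  by apply: open_ereal_gt'; rewrite lte_fin.
move=> [n _ /(_ n (leqnn n))]; rewrite /F /= normal_prob_itvcc.
  by rewrite lte_fin => ?; exists n%:R.
by rewrite ge0_cp.
Qed.

(** Standardizing [x = m + sd * y] turns the event into [|y + p| <= L]. The sign of [L] matters: for
    negative [L] the left side is 0 and the right side negative. *)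
Lemma integral_normal_window m (sd p L : R) : 0 < sd -> 0 <= L ->
  (\int[mu]_x ((`|x - m + sd * p| <= L * sd)%R%:R * normal_pdf m sd x)%:E)%E =
  (Phi (L - p) - Phi (- L - p))%:E.
Proof.
move=> sd0 L0; rewrite -normal_prob_itvcc; last by lra.
rewrite (ge0_integral_affine m sd0); last 2 first.
- apply/measurable_EFinP/measurable_funM; last exact: measurable_normal_pdf.
  apply: (measurableT_comp (f := fun b : bool => b%:R : R)) => //.
  apply: measurable_fun_ler => //; apply: measurableT_comp => //.
  by apply: measurable_funD => //; exact: measurable_funB.
- by move=> x; rewrite lee_fin mulr_ge0 // normal_pdf_ge0.
rewrite -ge0_integralZl_EFin //; last 3 first.
- by move=> x _; rewrite lee_fin mulr_ge0 // normal_pdf_ge0.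
- apply/measurable_EFinP/measurable_funM; last first.
    apply: measurable_normal_pdf_comp.
    by apply: measurable_funD => //; exact: measurable_funM.
  apply: (measurableT_comp (f := fun b : bool => b%:R : R)) => //.
  apply: measurable_fun_ler => //; apply: measurableT_comp => //.
  apply: measurable_funD => //; apply: measurable_funB => //.
  by apply: measurable_funD => //; exact: measurable_funM.
- exact: ltW.
rewrite /normal_prob [RHS]integral_mkcond; apply: eq_integral => y _.
rewrite patchE -EFinM (_ : m + sd * y - m + sd * p = (y + p) * sd); last by ring.
rewrite normrM (gtr0_norm sd0) ler_pM2r //.
have -> : (y \in `[- L - p, L - p]%classic) = (`|y + p| <= L).
  rewrite mem_setE in_itv /= ler_norml; apply/andP/andP => -[? ?]; split; lra.
case: ifP => _; last by rewrite mul0r mulr0.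
rewrite mul1r !normal_pdf_std // subr0 divr1 mul1r; congr EFin.
rewrite (_ : (m + sd * y - m) / sd = y); last by field; rewrite gt_eqF.
rewrite invfM; field.
by rewrite !gt_eqF // sqrtr_gt0 mulrn_wgt0 // pi_gt0.
Qed.

End NormalDensity.

(** * Inverse and determinant of V, and factorization of the joint density *)

Section GaussianAlgebra.
Context {R : realType} {K : nat}.
Variables (s0 : R) (s : 'I_K -> R).
Hypotheses (s0_gt0 : 0 < s0) (s_gt0 : forall j, 0 < s j).
Local Notation gamma := (gam s0 s).
Local Notation D := (1 + Defs.gnorm s0 s).

Lemma gam_gt0 j : 0 < gamma j.
Proof. by rewrite /gam divr_gt0 // exprn_gt0. Qed.

Lemma gnormS_gt0 : 0 < D.
Proof. by rewrite ltr_pwDl // sumr_ge0 // => j _; exact/ltW/gam_gt0. Qed.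

Lemma sum_delta (f : 'I_K -> R) i : \sum_k f k * (k == i)%:R = f i.
Proof.
rewrite (bigD1 i) //= eqxx mulr1 big1 ?addr0 // => k ki.
by rewrite (negbTE ki) mulr0.
Qed.

(* Sherman-Morrison for [V = diag(gamma)^-1 + 1 1^T]. *)
Lemma invmx_Vmat : invmx (Vmat s0 s) =
  \matrix_(i, j) (gamma i * (i == j)%:R - gamma i * gamma j / D).
Proof.
set W := \matrix_(i, j) _.
have WV : W *m Vmat s0 s = 1%:M.
  apply/matrixP => i j; rewrite !mxE.
  transitivity (\sum_k (gamma i * (1 + (gamma k)^-1 * (k == j)%:R) * (k == i)%:R -
      gamma i / D * gamma k - gamma i / D * (k == j)%:R)).
    apply: eq_bigr => k _; rewrite !mxE (eq_sym i k).
    by field; rewrite !gt_eqF ?gam_gt0 ?gnormS_gt0.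
  rewrite !sumrB !sum_delta -mulr_sumr -/(Defs.gnorm s0 s).
  have := gnormS_gt0; have := gam_gt0 i; move: (Defs.gnorm s0 s) (gamma i) => g c c0 g0.
  by field; rewrite !gt_eqF.
have [_ Vu] := mulmx1_unit WV.
by rewrite -[LHS]mul1mx -WV mulmxK.
Qed.

(** The bordered matrix [A] is factored through each of its two Schur complements: eliminating the
    corner 1 leaves V, eliminating the diagonal block leaves the scalar [D]. *)
Lemma det_Vmat : \det (Vmat s0 s) = D / \prod_j gamma j.
Proof.
pose e : 'rV[R]_K := const_mx 1.
pose Dg : 'M[R]_K := diag_mx (\row_j (gamma j)^-1).
pose G : 'rV[R]_K := \row_j gamma j.
pose A : 'M[R]_(1 + K) := block_mx 1%:M (- e) e^T Dg.
have VE : Vmat s0 s = Dg + e^T *m e.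
  apply/matrixP => i j; rewrite !mxE big_ord1 !mxE mulr1 addrC; congr (_ + _).
  by rewrite mulr_natr.
have A1 : A = block_mx 1%:M 0 e^T 1%:M *m block_mx 1%:M (- e) 0 (Vmat s0 s).
  rewrite mulmx_block !mul1mx !mul0mx !addr0 mulmx1.
  by rewrite mulmxN VE addrC addrK.
have A2 : A = block_mx D%:M (- G) 0 1%:M *m block_mx 1%:M 0 e^T Dg.
  rewrite mulmx_block !mulmx1 !mul0mx !mul1mx !add0r !mulmx0 ?addr0 ?add0r.
  congr (block_mx _ _ _ _).
    apply/matrixP => i j; rewrite mulNmx !mxE !ord1 eqxx mulr1n.
    under eq_bigr => k _ do rewrite !mxE mulr1.
    by rewrite addrK.
  rewrite mulNmx; congr (- _); apply/matrixP => i j; rewrite !mxE.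
  rewrite (bigD1 j) //= big1 ?addr0.
    by rewrite !mxE eqxx mulfV // gt_eqF // gam_gt0.
  by move=> k kj; rewrite !mxE (negbTE kj) mulr0.
have : \det A = \det A by [].
rewrite {1}A1 A2 !det_mulmx !det_lblock !det_ublock !det1 !mul1r mulr1 det_scalar1 => ->.
rewrite det_diag; congr (_ * _); rewrite -prodfV.
by apply: eq_bigr => j _; rewrite mxE.
Qed.

(** The subtracted square is the term released when the square in [x0] is completed; discarding it
    later bounds the density from below. *)
Lemma Vmat_quadratic (v : 'rV[R]_K) :
  (v *m invmx (Vmat s0 s) *m v^T) 0 0 =
  \sum_j gamma j * v 0 j ^+ 2 - (\sum_j gamma j * v 0 j) ^+ 2 / D.
Proof.
rewrite invmx_Vmat mxE.
transitivity (\sum_j (gamma j * v 0 j ^+ 2 -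
    gamma j * v 0 j * (\sum_i gamma i * v 0 i) / D)).
  apply: eq_bigr => j _; rewrite !mxE.
  transitivity ((\sum_i (v 0 i * gamma i * (i == j)%:R -
      gamma i * v 0 i * (gamma j / D))) * v 0 j).
    by congr (_ * _); apply: eq_bigr => i _; rewrite !mxE; ring.
  by rewrite sumrB sum_delta -mulr_suml; ring.
by rewrite sumrB; congr (_ - _); rewrite -!mulr_suml -expr2.
Qed.

(** [s0 ^+ K] is the Jacobian of [x_j = x0 + s0 * u_j]. The last factor is the conditional density
    of the first observation given the scaled differences [u]. *)
Lemma Vmat_density_factor (tau x0 : R) (t : 'I_K -> R) (u : 'rV[R]_K) :
  s0 ^+ K * (normal_pdf tau s0 x0 *
    \prod_j normal_pdf (tau + s0 * t j) (s j) (x0 + s0 * u 0 j)) =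
  mvn_pdf (\row_j t j) (Vmat s0 s) u *
  normal_pdf (tau - s0 * (\sum_j gamma j * (u 0 j - t j)) / D)
    (s0 / Num.sqrt D) x0.
Proof.
have D0 := gnormS_gt0; have sD0 : 0 < Num.sqrt D by rewrite sqrtr_gt0.
rewrite normal_pdf_std // normal_pdf_std ?divr_gt0 //.
rewrite (eq_bigr _ (fun j _ => normal_pdf_std _ _ (s_gt0 j))).
rewrite big_split /= -expR_sum.
set r := Num.sqrt (pi *+ 2); have r0 : 0 < r by rewrite sqrtr_gt0 mulrn_wgt0 // pi_gt0.
rewrite /mvn_pdf Vmat_quadratic det_Vmat -/r.
have vE (j : 'I_K) : (u - \row_i t i) 0 j = u 0 j - t j by rewrite !mxE.
rewrite (eq_bigr _ (fun j _ => congr1 (fun y => gamma j * y ^+ 2) (vE j))).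
rewrite (eq_bigr (fun j => gamma j * (u 0 j - t j)) (fun j _ => congr1 (fun y => gamma j * y) (vE j))).
set S := \sum_j gamma j * (u 0 j - t j).
set Q := \sum_j gamma j * (u 0 j - t j) ^+ 2.
set E := \sum_(j < K) _.
(* With [a = (x0 - tau) / s0], the j-th exponent is [- gamma j * (a + u_j - t_j)^2 / 2]; expanding
   it produces [gnorm], [S] and [Q]. *)
have EE : E = - (Defs.gnorm s0 s * ((x0 - tau) / s0) ^+ 2 +
    (x0 - tau) / s0 * S *+ 2 + Q) / 2.
  rewrite /E /Defs.gnorm /S /Q mulr_suml mulr_sumr -sumrMnl -!big_split /= -sumrN mulr_suml.
  apply: eq_bigr => j _; rewrite /gam; field.
  by rewrite !gt_eqF.
(* The Jacobian turns each [1 / s j] into [s0 / s j], the square root of [gamma j]. *)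
have cE : s0 ^+ K * \prod_(j < K) (s j * r)^-1 =
    r ^- K * Num.sqrt (\prod_j gamma j).
  have -> : \prod_j gamma j = (\prod_j (s0 / s j)) ^+ 2.
    rewrite -prodrXl; apply: eq_bigr => j _; rewrite /gam.
    by rewrite exprMn exprVn.
  rewrite sqrtr_sqr ger0_norm; last by apply: prodr_ge0 => j _; rewrite divr_ge0 // ltW.
  have powE (a : R) : a ^+ K = \prod_(j < K) a by rewrite prodr_const card_ord.
  rewrite -exprVn !powE -!big_split /=.
  by apply: eq_bigr => j _; rewrite invfM mulrA mulrC.
have P0 : 0 < \prod_j gamma j by apply: prodr_gt0 => j _; exact: gam_gt0.
rewrite sqrtrM; last exact: ltW.
rewrite sqrtrV; last exact: ltW.
set P := Num.sqrt _ in cE *.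
have sP0 : 0 < P by rewrite sqrtr_gt0.
transitivity ((s0 * r)^-1 * (s0 ^+ K * \prod_(j < K) (s j * r)^-1) *
   expR (- ((x0 - tau) / s0) ^+ 2 / 2 + E)).
  by rewrite expRD; ring.
rewrite cE EE.
(* Completing the square: [D a^2 + 2 a S + Q = D (a + S / D)^2 + Q - S^2 / D]. *)
transitivity ((s0 * r)^-1 * (r ^- K * P) *
   expR (- (Q - S ^+ 2 / D) / 2 + - ((x0 - (tau - s0 * S / D)) / (s0 / Num.sqrt D)) ^+ 2 / 2)).
  congr (_ * expR _).
  have : Num.sqrt D ^+ 2 = D by rewrite sqr_sqrtr // ltW.
  move: (Num.sqrt D) sD0 => q q0 qE.
  have -> : Defs.gnorm s0 s = q ^+ 2 - 1 by rewrite qE addrAC subrr add0r.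
  by field; rewrite subrKC expf_eq0 /= !gt_eqF.
rewrite expRD.
rewrite !invfM !invrK.
field.
by rewrite !gt_eqF // exprn_gt0.
Qed.

End GaussianAlgebra.

(** * From the observations to their scaled differences *)

Section Transfer.
Context {R : realType} {K : nat}.
Local Notation mu := (@lebesgue_measure R).

(** The counterpart of [smeasurable] for a real and a row vector; testing on measurable families
    lets coordinate changes be handled by composition. *)
Definition rmeasurable (w : R -> 'rV[R]_K -> R) : Prop :=
  forall d (T : measurableType d) (g : T -> R) (X : T -> 'rV[R]_K),
    measurable_fun [set: T] g ->
    (forall j, measurable_fun [set: T] (fun y => X y 0 j)) ->
    measurable_fun [set: T] (fun y => w (g y) (X y)).

Lemma measurable_row_mkseq d (T : measurableType d) (g : nat -> T -> R) j :
  (forall i, measurable_fun [set: T] (g i)) ->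
  measurable_fun [set: T]
    (fun y => (\row_(k < K) nth 0 (mkseq (fun i => g i y) K) k : 'rV[R]_K) 0 j).
Proof. by move=> mg; under eq_fun do rewrite mxE nth_mkseq //; exact: mg. Qed.

Lemma smeasurable_cons_row (w : R -> 'rV[R]_K -> R) : rmeasurable w ->
  smeasurable K.+1
    (fun z => (w (head 0 z) (\row_(j < K) nth 0 (behead z) j))%:E).
Proof.
move=> mw; apply: smeasurable_EFin => d T g mg.
under eq_fun do rewrite mkseqS_cons /=.
by apply: mw => // j; apply: (measurable_row_mkseq (g := fun i => g i.+1)).
Qed.

Lemma smeasurable_row (w : R -> 'rV[R]_K -> R) x0 : rmeasurable w ->
  smeasurable K (fun z => (w x0 (\row_(j < K) nth 0 z j))%:E).
Proof. by move=> /smeasurable_cons_row/smeasurable_consl; exact. Qed.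

Lemma rmeasurableM w1 w2 : rmeasurable w1 -> rmeasurable w2 ->
  rmeasurable (fun x0 x => w1 x0 x * w2 x0 x).
Proof.
by move=> m1 m2 d T g X mg mX; apply: measurable_funM; [exact: m1|exact: m2].
Qed.

Lemma rmeasurable_prod (f0 : R -> R) (f : 'I_K -> R -> R) :
  measurable_fun [set: R] f0 -> (forall j, measurable_fun [set: R] (f j)) ->
  rmeasurable (fun x0 x => f0 x0 * \prod_j f j (x 0 j)).
Proof.
move=> m0 mf d T g X mg mX; apply: measurable_funM.
  exact: measurableT_comp.
by apply: measurable_prod => j _; exact: (measurableT_comp (mf j)).
Qed.

Lemma intRK_prod (f : 'I_K -> R -> R) :
  (forall j, measurable_fun [set: R] (f j)) -> (forall j x, 0 <= f j x) ->
  intRK (fun x : 'rV[R]_K => (\prod_j f j (x 0 j))%:E) =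
  (\prod_j \int[mu]_x (f j x)%:E)%E.
Proof.
(* [iint_prod] wants factors indexed by [nat]; the default 0 is never reached for indices below
   [K]. *)
move=> mf f0; pose h (i : nat) x := if insub i is Some j then f j x else 0.
rewrite /intRK (eq_iint (g := fun s => (\prod_(i < K) h i (nth 0 s i))%:E)).
  rewrite iint_prod.
  - by apply: eq_bigr => j _; rewrite /h valK.
  - by move=> i; rewrite /h; case: insub.
  - by move=> i x; rewrite /h; case: insub.
move=> s _; congr EFin; apply: eq_bigr => j _.
by rewrite mxE /h valK.
Qed.

Lemma integral_intRK_prod (f0 : R -> R) (f : 'I_K -> R -> R) :
  measurable_fun [set: R] f0 -> (forall x, 0 <= f0 x) ->
  (forall j, measurable_fun [set: R] (f j)) -> (forall j x, 0 <= f j x) ->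
  (\int[mu]_x0 intRK (fun x : 'rV[R]_K => (f0 x0 * \prod_j f j (x 0 j))%:E) =
   (\int[mu]_x (f0 x)%:E) * \prod_j \int[mu]_x (f j x)%:E)%E.
Proof.
move=> m0 p0 mf pf; rewrite muleC -ge0_integralZl //; last 3 first.
- exact/measurable_EFinP.
- by move=> x _; rewrite lee_fin p0.
- by apply: prode_ge0 => j _; apply: integral_ge0 => x _; rewrite lee_fin pf.
apply: eq_integral => x0 _; rewrite muleC -intRK_prod //.
rewrite /intRK -iintZl //.
  apply: (smeasurable_row (w := fun=> fun x => \prod_j f j (x 0 j)) 0).
  move=> d T g X mg mX; apply: measurable_prod => j _.
  exact: (measurableT_comp (mf j)).
by move=> s; rewrite lee_fin prodr_ge0.
Qed.

Variables (s0 : R) (s : 'I_K -> R).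
Hypotheses (s0_gt0 : 0 < s0) (s_gt0 : forall j, 0 < s j).
Local Notation gamma := (gam s0 s).
Local Notation D := (1 + Defs.gnorm s0 s).

Lemma mvn_pdf_ge0 (t u : 'rV[R]_K) V : 0 <= mvn_pdf t V u.
Proof. by rewrite !mulr_ge0 ?expR_ge0 // invr_ge0 ?exprn_ge0. Qed.

(* The change of variables [x_j = x0 + s0 u_j], followed by exchanging the
   integrals so that [x0] becomes the innermost variable. *)
Lemma integral_pretest_coordinates (w : R -> 'rV[R]_K -> R) (tau : R)
    (t : 'I_K -> R) :
  rmeasurable w -> (forall x0 x, 0 <= w x0 x) ->
  (\int[mu]_x0 intRK (fun x : 'rV[R]_K => (w x0 x * normal_pdf tau s0 x0 *
     \prod_j normal_pdf (tau + s0 * t j) (s j) (x 0 j))%:E) =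
   intRK (fun u : 'rV[R]_K => (mvn_pdf (\row_j t j) (Vmat s0 s) u)%:E *
     \int[mu]_x0 (w x0 (\row_j (x0 + s0 * u 0 j)) *
       normal_pdf (tau - s0 * (\sum_j gamma j * (u 0 j - t j)) / D)
         (s0 / Num.sqrt D) x0)%:E))%E.
Proof.
move=> mw w0.
pose F x0 (x : 'rV[R]_K) := w x0 x * (normal_pdf tau s0 x0 *
     \prod_j normal_pdf (tau + s0 * t j) (s j) (x 0 j)).
have mF : rmeasurable F.
  apply: rmeasurableM => //.
  apply: (rmeasurable_prod (f := fun j => normal_pdf (tau + s0 * t j) (s j))).
    exact: measurable_normal_pdf.
  by move=> j; exact: measurable_normal_pdf.
have F0 x0 x : 0 <= F x0 x.
  rewrite mulr_ge0 // mulr_ge0 ?normal_pdf_ge0 //.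
  by apply: prodr_ge0 => j _; exact: normal_pdf_ge0.
pose G x0 (u : 'rV[R]_K) := s0 ^+ K * F x0 (\row_j (x0 + s0 * u 0 j)).
have mG : rmeasurable G.
  move=> d T g X mg mX; apply: measurable_funM => //; apply: mF => // j.
  under eq_fun do rewrite mxE.
  by apply: measurable_funD => //; exact: measurable_funM.
have G0 x0 x : 0 <= G x0 x by rewrite mulr_ge0 // exprn_ge0 // ltW.
transitivity (\int[mu]_x0 iint K
    (fun z => (G x0 (\row_(j < K) nth 0 z j))%:E))%E.
  apply: eq_integral => x0 _; rewrite /intRK.
  under eq_iint do rewrite -mulrA -/(F _ _).
  rewrite (iint_affine x0 s0_gt0); last 2 first.
  - exact: (smeasurable_row (w := F) x0 mF).
  - by move=> z; rewrite lee_fin F0.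
  rewrite -iintZl; last 3 first.
  - move=> d T g mg; apply/measurable_EFinP; apply: mF => // j.
    under eq_fun do rewrite mxE -map_comp nth_mkseq //=.
    by apply: measurable_funD => //; exact: measurable_funM.
  - by move=> z; rewrite lee_fin F0.
  - by rewrite exprn_ge0 // ltW.
  apply: eq_iint => z zK; rewrite -EFinM /G; congr (_ * F _ _)%:E.
  by apply/rowP => j; rewrite !mxE (nth_map 0) // zK.
rewrite (iint_tonelli (f := fun z =>
  (G (head 0 z) (\row_(j < K) nth 0 (behead z) j))%:E)); last 2 first.
- exact: smeasurable_cons_row.
- by move=> z; rewrite lee_fin.
rewrite /intRK; apply: eq_iint => z _ /=.
set u := \row_(j < K) _.
rewrite -ge0_integralZl_EFin //; last 3 first.
- by move=> x _; rewrite lee_fin mulr_ge0 // normal_pdf_ge0.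
- apply/measurable_EFinP/measurable_funM; last exact: measurable_normal_pdf.
  apply: mw => // j; under eq_fun do rewrite mxE.
  exact: measurable_funD.
- exact: mvn_pdf_ge0.
apply: eq_integral => x0 _; rewrite -EFinM; congr EFin.
rewrite mulrCA -Vmat_density_factor // /G /F.
under eq_bigr do rewrite mxE.
by rewrite mulrCA.
Qed.

(** The coordinate change with [w = 1] identifies this mass with a product of K+1 one-dimensional
    normal masses. *)
Lemma mvn_pdf_mass (t : 'I_K -> R) :
  intRK (fun u : 'rV[R]_K => (mvn_pdf (\row_j t j) (Vmat s0 s) u)%:E) = 1%E.
Proof.
have := @integral_pretest_coordinates (fun _ _ => 1) 0 t.
move=> /(_ _ (fun _ _ => ler01)).
have m1 : rmeasurable (fun _ _ => 1) by move=> d T g X mg mX; exact: measurable_cst.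
move=> /(_ m1) E.
transitivity (intRK (fun u : 'rV[R]_K => (mvn_pdf (\row_j t j) (Vmat s0 s) u)%:E *
     \int[mu]_x0 (1 *
       normal_pdf (0 - s0 * (\sum_j gamma j * (u 0 j - t j)) / D)
         (s0 / Num.sqrt D) x0)%:E))%E.
  rewrite /intRK; apply: eq_iint => z _.
  under eq_integral do rewrite mul1r.
  by rewrite integral_normal_pdf mule1.
rewrite -E.
rewrite (_ : (fun x0 : R => _) = fun x0 => intRK (fun x : 'rV[R]_K =>
    (normal_pdf 0 s0 x0 * \prod_j normal_pdf (0 + s0 * t j) (s j) (x 0 j))%:E)); last first.
  by apply/funext => x0; congr (intRK _); apply/funext => x; rewrite mul1r.
rewrite (integral_intRK_prod (f := fun j => normal_pdf (0 + s0 * t j) (s j))).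
- by rewrite integral_normal_pdf mul1e big1 // => j _; rewrite integral_normal_pdf.
- exact: measurable_normal_pdf.
- by move=> x; exact: normal_pdf_ge0.
- by move=> j; exact: measurable_normal_pdf.
- by move=> j x; exact: normal_pdf_ge0.
Qed.

Variable alpha : R.

Lemma rmeasurable_tauPT : rmeasurable (fun x0 x => tauPT s0 s alpha x0 (fun j => x 0 j)).
Proof.
move=> d T g X mg mX; rewrite /tauPT; apply: measurable_funD => //.
apply: measurable_sum => j; apply: measurable_funM.
  by apply: measurable_funM => //; exact: measurable_funB.
apply: (measurableT_comp (f := fun b : bool => b%:R : R)) => //.
by apply: measurable_fun_ler => //; apply: measurableT_comp => //; exact: measurable_funB.
Qed.

(** Acceptance of pretest j means that [u_j] is below its threshold, so the accepted part of [u] is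
    [u - u']. Splitting it as [(u - t) + (t - u')] isolates the conditional mean and leaves the bias
    in the shape required by [integral_normal_window]. *)
Lemma tauPT_shift (tau x0 : R) (t : 'I_K -> R) (u : 'rV[R]_K) :
  tauPT s0 s alpha x0 (fun j => (\row_j (x0 + s0 * u 0 j) : 'rV[R]_K) 0 j) - tau =
  x0 - (tau - s0 * (\sum_j gamma j * (u 0 j - t j)) / D) +
  s0 / Num.sqrt D * ((\sum_j gamma j * (t j - u 0 j *
    (Num.sqrt (1 + (gamma j)^-1) * crit (alpha / 2) < `|u 0 j|)%R%:R))
      / Num.sqrt D).
Proof.
have D0 := gnormS_gt0 s0_gt0 s_gt0.
have DE : Num.sqrt D ^+ 2 = D by rewrite sqr_sqrtr // ltW.
have sD0 : 0 < Num.sqrt D by rewrite sqrtr_gt0.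
rewrite /tauPT.
rewrite (_ : s0 / Num.sqrt D * (_ / Num.sqrt D) = s0 * (\sum_j gamma j * (t j - u 0 j *
    (Num.sqrt (1 + (gamma j)^-1) * crit (alpha / 2) < `|u 0 j|)%R%:R)) / D); last first.
  by rewrite -[in RHS]DE; field; rewrite gt_eqF.
rewrite opprB addrA addrAC -[RHS]addrA -mulrDl -mulrDr -big_split /=.
rewrite [RHS]addrAC; congr (_ + _ - _).
rewrite mulr_sumr mulr_suml; apply: eq_bigr => j _; rewrite !mxE.
rewrite (_ : x0 + s0 * u 0 j - x0 = s0 * u 0 j); last by ring.
rewrite normrM (gtr0_norm s0_gt0) (mulrC s0 (Num.norm _)) (mulrAC _ s0 (crit _)) ler_pM2r // leNgt.
by case: (_ < _) => /=; field; rewrite gt_eqF.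
Qed.

Lemma PT_prob_mvn (tau L : R) (t : 'I_K -> R) : 0 <= L ->
  PT_prob s0 s alpha tau (fun j => s0 * t j) L = rhs_i s0 s alpha t L.
Proof.
move=> L0; have D0 := gnormS_gt0 s0_gt0 s_gt0.
rewrite /PT_prob (integral_pretest_coordinates (w := fun x0 x =>
  (`|tauPT s0 s alpha x0 (fun j => x 0 j) - tau|
     <= L * (Num.sqrt D)^-1 * s0)%R%:R)) //; last first.
  move=> d T g X mg mX.
  apply: (measurableT_comp (f := fun b : bool => b%:R : R)) => //.
  apply: measurable_fun_ler => //; apply: measurableT_comp => //.
  by apply: measurable_funB => //; exact: rmeasurable_tauPT.
rewrite /rhs_i /intRK; apply: eq_iint => z _ /=.
set u := \row_(j < K) nth 0 z j.
rewrite [RHS]EFinM muleC; congr (_ * _)%E.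
(* The allowed error is [L] times the conditional standard deviation [s0 / Num.sqrt D]. *)
rewrite -(integral_normal_window (tau - s0 * (\sum_j gamma j * (u 0 j - t j)) / D)
  (sd := s0 / Num.sqrt D)) //; last by rewrite divr_gt0 // sqrtr_gt0.
apply: eq_integral => x0 _.
by rewrite (tauPT_shift tau x0 t u) (mulrAC L) -(mulrA L).
Qed.

End Transfer.

(** * Infimum of a uniformly Lipschitz, uniformly increasing family *)

Section InfimumCoverage.
Context {R : realType} {I : Type}.
Variables (B : set I) (P : I -> R -> \bar R) (C p : R).
Hypotheses (B_nonempty : B !=set0) (C_ge0 : 0 <= C) (p_gt0 : 0 < p).
Hypothesis P_at0 : forall i, B i -> P i 0 = 0%E.
Hypothesis P_lipschitz : forall i L1 L2, B i -> 0 <= L1 -> L1 <= L2 ->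
  (P i L2 <= P i L1 + (C * (L2 - L1))%:E)%E.
(** The gap [e] precedes the index because an infimum of strictly increasing functions need not be
    strictly increasing. *)
Hypothesis P_increase : forall L1 L2, 0 <= L1 -> L1 < L2 ->
  exists2 e : R, 0 < e & forall i, B i -> (P i L1 + e%:E <= P i L2)%E.
Hypothesis P_reaches : exists2 L, 0 <= L & forall i, B i -> (p%:E <= P i L)%E.

Let h L := ereal_inf [set P i L | i in B].

Lemma infcov_at0 : h 0 = 0%E.
Proof.
rewrite /h (_ : [set _ | _ in _] = [set 0%E]) ?ereal_inf1 //.
apply/seteqP; split => [_ [i Bi <-]|_ ->]; first exact: P_at0.
by have [i Bi] := B_nonempty; exists i => //; exact: P_at0.
Qed.

Lemma infcov_lipschitz L1 L2 : 0 <= L1 -> L1 <= L2 ->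
  (h L2 <= h L1 + (C * (L2 - L1))%:E)%E.
Proof.
move=> L10 L12; rewrite -leeBlDr //; apply: le_ereal_inf_tmp => _ [i Bi <-].
rewrite leeBlDr //; apply: le_trans (P_lipschitz Bi L10 L12).
by apply: ereal_inf_lbound; exists i.
Qed.

Lemma infcov_increase L1 L2 : 0 <= L1 -> L1 < L2 ->
  exists2 e : R, 0 < e & (h L1 + e%:E <= h L2)%E.
Proof.
move=> L10 L12; have [e e0 Pe] := P_increase L10 L12.
exists e => //; apply: le_ereal_inf_tmp => _ [i Bi <-].
apply: le_trans (Pe _ Bi); rewrite leeD2r //.
by apply: ereal_inf_lbound; exists i.
Qed.

Lemma infcov_le L1 L2 : 0 <= L1 -> L1 <= L2 -> (h L1 <= h L2)%E.
Proof.
move=> L10; rewrite le_eqVlt => /predU1P[-> //|L12].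
have [e e0] := infcov_increase L10 L12; apply: le_trans.
by rewrite leeDl // lee_fin ltW.
Qed.

Lemma infcov_fin L : 0 <= L -> h L = (fine (h L))%:E.
Proof.
move=> L0; have h0 : (0 <= h L)%E by rewrite -infcov_at0 infcov_le.
rewrite fineK // ge0_fin_numE //.
by apply: le_lt_trans (infcov_lipschitz (lexx 0) L0) _; rewrite infcov_at0 add0e ltry.
Qed.

Let A := [set L : R | 0 <= L /\ (p%:E <= h L)%E].

Lemma infcov_has_inf : has_inf A.
Proof.
split; last by exists 0 => L [].
have [L L0 PL] := P_reaches.
by exists L; split => //; apply: le_ereal_inf_tmp => _ [i Bi <-]; exact: PL.
Qed.

Lemma infcov_inf_ge0 : 0 <= inf A.
Proof. by apply: lb_le_inf => [|L []//]; case: infcov_has_inf. Qed.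

(** If the value exceeded [p], a small step to the left would stay in [A]; if it were below [p],
    points of [A] near the infimum would break the Lipschitz bound. *)
Lemma infcov_inf : h (inf A) = p%:E.
Proof.
have A0 := infcov_inf_ge0; have Ai := infcov_has_inf.
rewrite infcov_fin //; congr EFin; apply/eqP; rewrite eq_le; apply/andP; split.
  rewrite leNgt; apply/negP => ph.
  have i0 : 0 < inf A.
    rewrite lt_neqAle A0 andbT; apply/negP => /eqP E.
    by move: ph; rewrite -E infcov_at0 /= => /(lt_trans p_gt0); rewrite ltxx.
  have [d [d0 dA dp]] : exists d : R, [/\ 0 < d, d <= inf A & C * d <= fine (h (inf A)) - p].
    (* The minimum keeps [inf A - d] nonnegative; the divisor is [C + 1] because [C] may be 0. *)
    exists (Num.min (inf A) ((fine (h (inf A)) - p) / (C + 1))).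
    have C1 : 0 < C + 1 by rewrite ltr_wpDl.
    have q0 : 0 < (fine (h (inf A)) - p) / (C + 1) by rewrite divr_gt0 // subr_gt0.
    split; [by rewrite lt_min i0 q0|by rewrite ge_min lexx|].
    apply: (@le_trans _ _ ((C + 1) * ((fine (h (inf A)) - p) / (C + 1)))).
      by apply: ler_pM; rewrite ?ge_min ?lexx ?orbT ?le_min ?A0 ?(ltW q0) // lerDl.
    by rewrite mulrC divfK // gt_eqF.
  have dA0 : 0 <= inf A - d by rewrite subr_ge0.
  have : A (inf A - d).
    split => //; have := @infcov_lipschitz (inf A - d) (inf A) dA0.
    rewrite gerBl ltW // => /(_ isT).
    rewrite (infcov_fin A0) (infcov_fin dA0) -EFinD !lee_fin.
    by rewrite opprB addrCA subrr addr0; lra.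
  by move=> /(ge_inf Ai.2); lra.
apply/ler_addgt0Pr => e e0.
have C1 : 0 < C + 1 by rewrite ltr_wpDl.
have [L [L0 pL] LA] := inf_adherent (divr_gt0 e0 C1) Ai.
have AL : inf A <= L by apply: ge_inf => //; exact: Ai.2.
have := infcov_lipschitz A0 AL; move: pL.
rewrite (infcov_fin A0) (infcov_fin L0) -EFinD !lee_fin => pL hL.
apply: (le_trans pL); apply: (le_trans hL); rewrite lerD2l.
apply: (@le_trans _ _ ((C + 1) * (e / (C + 1)))); last by rewrite mulrC divfK // gt_eqF.
by apply: ler_pM; rewrite ?subr_ge0 ?lerDl //; rewrite lerBlDl ltW.
Qed.

Lemma infcov_unique L : 0 <= L -> h L = p%:E -> L = inf A.
Proof.
move=> L0 hL; have A0 := infcov_inf_ge0.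
apply/eqP; rewrite eq_le !leNgt; apply/andP; split; apply/negP => lt.
  have [e e0] := infcov_increase A0 lt.
  by rewrite infcov_inf hL -EFinD lee_fin gerDl leNgt e0.
have [e e0] := infcov_increase L0 lt.
by rewrite infcov_inf hL -EFinD lee_fin gerDl leNgt e0.
Qed.

(** This yields minimality of the half-length: [h] is monotone and attains [p] at [inf A], so the
    admissible values form a closed half-line. *)
Lemma infcov_geP L : 0 <= L -> (p%:E <= h L)%E <-> inf A <= L.
Proof.
move=> L0; split => [pL|AL].
  by apply: ge_inf => //; exact: infcov_has_inf.2.
by rewrite -infcov_inf; apply: infcov_le => //; exact: infcov_inf_ge0.
Qed.

End InfimumCoverage.

(** * Order and linearity of integrals over row vectors *)

Section RowIntegrals.
Context {R : realType} {K : nat}.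
Local Notation mu := (@lebesgue_measure R).
Implicit Types f g : 'rV[R]_K -> R.

Lemma le_intRK f g : rmeasurable (fun=> f) -> rmeasurable (fun=> g) ->
  (forall u, 0 <= f u) -> (forall u, f u <= g u) ->
  (intRK (fun u => (f u)%:E) <= intRK (fun u => (g u)%:E))%E.
Proof.
move=> mf mg f0 fg; rewrite /intRK.
apply: le_iint => [||z|z|z _]; rewrite ?lee_fin //.
- exact: (smeasurable_row 0 mf).
- exact: (smeasurable_row 0 mg).
- exact: le_trans (fg _).
Qed.

Lemma intRKD f g : rmeasurable (fun=> f) -> rmeasurable (fun=> g) ->
  (forall u, 0 <= f u) -> (forall u, 0 <= g u) ->
  (intRK (fun u => (f u + g u)%:E) =
   intRK (fun u => (f u)%:E) + intRK (fun u => (g u)%:E))%E.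
Proof.
move=> mf mg f0 g0; rewrite /intRK -iintD; first by apply: eq_iint => z _; rewrite EFinD.
- exact: (smeasurable_row 0 mf).
- exact: (smeasurable_row 0 mg).
- by move=> z; rewrite lee_fin.
- by move=> z; rewrite lee_fin.
Qed.

Lemma intRKZl f (k : R) : rmeasurable (fun=> f) -> (forall u, 0 <= f u) ->
  0 <= k -> (intRK (fun u => (k * f u)%:E) = k%:E * intRK (fun u => (f u)%:E))%E.
Proof.
move=> mf f0 k0; rewrite /intRK -iintZl //.
- exact: (smeasurable_row 0 mf).
- by move=> z; rewrite lee_fin.
Qed.

Lemma le_integral_intRK (w1 w2 : R -> 'rV[R]_K -> R) :
  rmeasurable w1 -> rmeasurable w2 -> (forall x0 x, 0 <= w1 x0 x) ->
  (forall x0 x, w1 x0 x <= w2 x0 x) ->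
  (\int[mu]_x0 intRK (fun x => (w1 x0 x)%:E) <=
   \int[mu]_x0 intRK (fun x => (w2 x0 x)%:E))%E.
Proof.
move=> m1 m2 w0 w12.
have := @le_iint R K.+1 _ _ (smeasurable_cons_row m1) (smeasurable_cons_row m2).
apply=> [z|z|z _]; rewrite lee_fin //.
exact: le_trans (w12 _ _).
Qed.

Lemma measurable_Phi : measurable_fun [set: R] (@Phi R).
Proof.
apply: nondecreasing_measurable => // x y xy.
by have /andP[] := Phi_lipschitz xy; rewrite subr_ge0.
Qed.

End RowIntegrals.

(** * Bounds on the coverage, uniform in the bias *)

Section PretestCoverage.
Context {R : realType} {K : nat}.
Local Notation mu := (@lebesgue_measure R).
Variables (s0 : R) (s : 'I_K -> R) (alpha : R).
Hypotheses (s0_gt0 : 0 < s0) (s_gt0 : forall j, 0 < s j).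
Local Notation gamma := (gam s0 s).
Local Notation D := (1 + Defs.gnorm s0 s).
Implicit Types (t b : 'I_K -> R) (u : 'rV[R]_K).

Let D_gt0 : 0 < D := gnormS_gt0 s0_gt0 s_gt0.
Let sqrtD_gt0 : 0 < Num.sqrt D. Proof. by rewrite sqrtr_gt0. Qed.

Local Notation density t u := (mvn_pdf (\row_j t j) (Vmat s0 s) u).

Definition pretest_shift t u : R :=
  (\sum_(j < K) gamma j * (t j - u 0 j *
     ((Num.sqrt (1 + (gamma j)^-1) * crit (alpha / 2) < `|u 0 j|)%R)%:R))
  / Num.sqrt D.

(** The conditional coverage given [u], with [pretest_shift] the conditional bias in units of the
    conditional standard deviation. *)
Definition pretest_window L t u : R :=
  Phi (L - pretest_shift t u) - Phi (- L - pretest_shift t u).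

Lemma window_ge0 L t u : 0 <= L -> 0 <= pretest_window L t u.
Proof.
move=> L0; suff /Phi_lipschitz/andP[] :
  - L - pretest_shift t u <= L - pretest_shift t u by []; lra.
Qed.

Lemma rmeasurable_density t : rmeasurable (fun=> fun u => density t u).
Proof.
move=> d T g X mg mX; rewrite /mvn_pdf.
under eq_fun do rewrite Vmat_quadratic //.
have mv j : measurable_fun [set: T] (fun y => (X y - \row_j t j) 0 j).
  by under eq_fun do rewrite !mxE; exact: measurable_funB.
apply: measurable_funM => //; apply: measurableT_comp => //.
apply: measurable_funM => //; apply: measurableT_comp => //.
apply: measurable_funB.
  apply: measurable_sum => j; apply: measurable_funM => //.
  exact: measurable_funX.
apply: measurable_funM => //; apply: measurable_funX.
by apply: measurable_sum => j; exact: measurable_funM.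
Qed.

Lemma rmeasurable_window L t : rmeasurable (fun=> pretest_window L t).
Proof.
move=> d T g X mg mX.
have mp : measurable_fun [set: T] (fun y => pretest_shift t (X y)).
  apply: measurable_funM => //; apply: measurable_sum => j.
  apply: measurable_funM => //; apply: measurable_funB => //.
  apply: measurable_funM => //.
  apply: (measurableT_comp (f := fun c : bool => c%:R : R)) => //.
  by apply: measurable_fun_ltr => //; exact: measurableT_comp.
apply: measurable_funB; apply: (measurableT_comp measurable_Phi);
  exact: measurable_funB.
Qed.

Lemma rmeasurable_window_density L t :
  rmeasurable (fun=> fun u => pretest_window L t u * density t u).
Proof.
apply: (rmeasurableM (w1 := fun=> pretest_window L t)).
  exact: rmeasurable_window.
exact: rmeasurable_density.
Qed.

Lemma rhs_iE t L : rhs_i s0 s alpha t L =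
  intRK (fun u => (pretest_window L t u * density t u)%:E).
Proof. by []. Qed.

Lemma rhs_i_at0 t : rhs_i s0 s alpha t 0 = 0%E.
Proof.
rewrite rhs_iE; transitivity (intRK (fun u => (0 * density t u)%:E)).
  rewrite /intRK; apply: eq_iint => z _; rewrite /pretest_window oppr0 subrr //.
rewrite intRKZl ?mul0e //; first exact: rmeasurable_density.
by move=> u; exact: mvn_pdf_ge0.
Qed.

(** Both endpoints of the window move by [L2 - L1], each costing at most the peak of the normal
    density; averaging over a probability density adds nothing, so the constant is free of [t]. *)
Lemma rhs_i_lipschitz t L1 L2 : 0 <= L1 -> L1 <= L2 ->
  (rhs_i s0 s alpha t L2 <=
   rhs_i s0 s alpha t L1 + (normal_peak 1 *+ 2 * (L2 - L1))%:E)%E.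
Proof.
move=> L10 L12; rewrite !rhs_iE.
have L20 : 0 <= L2 by exact: le_trans L12.
have q0 u : 0 <= density t u by exact: mvn_pdf_ge0.
have c0 : 0 <= normal_peak 1 *+ 2 * (L2 - L1).
  by rewrite mulr_ge0 ?subr_ge0 // mulrn_wge0 // normal_peak_ge0.
rewrite -[X in (_ <= _ + X)%E]mule1 -(mvn_pdf_mass s0_gt0 s_gt0 t) -intRKZl //; last 1 first.
  exact: rmeasurable_density.
have mkq : rmeasurable (fun=> fun u => normal_peak 1 *+ 2 * (L2 - L1) * density t u).
  by move=> d T g X mg mX; apply: measurable_funM => //; exact: (rmeasurable_density t mg mX).
rewrite -intRKD //; last 3 first.
- exact: rmeasurable_window_density.
- by move=> u; rewrite mulr_ge0 ?window_ge0.
- by move=> u; rewrite mulr_ge0.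
apply: le_intRK.
- exact: rmeasurable_window_density.
- move=> d T g X mg mX; apply: measurable_funD.
    exact: (rmeasurable_window_density _ t mg mX).
  exact: (mkq _ _ _ _ mg mX).
- by move=> u; rewrite mulr_ge0 ?window_ge0.
move=> u; rewrite -mulrDl ler_wpM2r // /pretest_window.
have /Phi_lipschitz/andP[_] : L1 - pretest_shift t u <= L2 - pretest_shift t u by lra.
have /Phi_lipschitz/andP[_] : - L2 - pretest_shift t u <= - L1 - pretest_shift t u by lra.
set p := pretest_shift t u; set k := normal_peak 1.
rewrite (_ : - L1 - p - (- L2 - p) = L2 - L1); last by ring.
rewrite (_ : L2 - p - (L1 - p) = L2 - L1); last by ring.
by rewrite mulrnAl mulr2n; lra.
Qed.

Lemma rhs_i_increase b L1 L2 : 0 <= L1 -> L1 < L2 ->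
  exists2 e : R, 0 < e & forall t, (forall j, `|t j| <= b j) ->
    (rhs_i s0 s alpha t L1 + e%:E <= rhs_i s0 s alpha t L2)%E.
Proof.
move=> L10 L12; have L20 : 0 <= L2 by lra.
(* On the cube [|u_j| <= 1] one has [|t_j - u'_j| <= b_j + 1], so all arguments of [Phi] used below
   lie in [[-M, M]]. *)
pose M := L2 + (\sum_j gamma j * (b j + 1)) / Num.sqrt D.
(* A lower bound for the density on the cube: the subtracted square is dropped and
   [|u_j - t_j| <= b_j + 1]. *)
pose q := (Num.sqrt (pi *+ 2)) ^- K * (Num.sqrt (\det (Vmat s0 s)))^-1 *
  expR (- (\sum_j gamma j * (b j + 1) ^+ 2) / 2).
have q0 : 0 < q.
  rewrite !mulr_gt0 ?expR_gt0 // invr_gt0.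
    by rewrite exprn_gt0 // sqrtr_gt0 mulrn_wgt0 // pi_gt0.
  rewrite sqrtr_gt0 det_Vmat // divr_gt0 //.
  by apply: prodr_gt0 => j _; exact: gam_gt0.
pose c := normal_pdf 0 1 M * (L2 - L1) * q.
have pdf0 : 0 < normal_pdf 0 1 M.
  rewrite normal_pdf_std // mulr_gt0 ?expR_gt0 // invr_gt0 mul1r.
  by rewrite sqrtr_gt0 mulrn_wgt0 // pi_gt0.
have c0 : 0 < c by do 2 (apply: mulr_gt0 => //); rewrite subr_gt0.
pose box (x : R) : R := (`|x| <= 1)%R%:R.
have mbox : measurable_fun [set: R] box.
  apply: (measurableT_comp (f := fun c : bool => c%:R : R)) => //.
  by apply: measurable_fun_ler => //; exact: measurableT_comp.
have ibox : (\int[mu]_x (box x)%:E = 2%:E)%E.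
  rewrite (_ : (fun x => _) = EFin \o \1_(`[-1, 1]%classic)); last first.
    apply/funext => x /=; rewrite /box indicE mem_setE in_itv /= -ler_norml.
    by [].
  rewrite integral_indic //= setIT lebesgue_measure_itv /= lte_fin.
  by rewrite (_ : -1 < 1); [rewrite -EFinB; congr EFin; lra|lra].
have mBox : rmeasurable (fun=> fun u : 'rV[R]_K => \prod_j box (u 0 j)).
  move=> d T g X mg mX; apply: measurable_prod => j _.
  exact: (measurableT_comp mbox).
have Box0 (u : 'rV[R]_K) : 0 <= \prod_j box (u 0 j) by exact: prodr_ge0.
(* [2 ^+ K] is the volume of the cube. *)
exists (c * 2 ^+ K); first by rewrite mulr_gt0 // exprn_gt0.
move=> t tb; rewrite !rhs_iE.
have d0 u : 0 <= density t u by exact: mvn_pdf_ge0.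
have -> : (c * 2 ^+ K)%:E = intRK (fun u : 'rV[R]_K => (c * \prod_j box (u 0 j))%:E).
  rewrite intRKZl // ?ltW // (intRK_prod (f := fun=> box)) //.
  under eq_bigr do rewrite ibox.
  by rewrite prodEFin prodr_const card_ord EFinM.
have mcBox : rmeasurable (fun=> fun u : 'rV[R]_K => c * \prod_j box (u 0 j)).
  by move=> d T g X mg mX; apply: measurable_funM => //; exact: (mBox _ _ _ _ mg mX).
rewrite -intRKD //; last 3 first.
- exact: rmeasurable_window_density.
- by move=> u; rewrite mulr_ge0 ?window_ge0.
- by move=> u; rewrite mulr_ge0 // ltW.
apply: le_intRK.
- move=> d T g X mg mX; apply: measurable_funD.
    exact: (rmeasurable_window_density _ t mg mX).
  exact: (mcBox _ _ _ _ mg mX).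
- exact: rmeasurable_window_density.
- by move=> u; apply: addr_ge0; apply: mulr_ge0 => //; [exact: window_ge0|exact: ltW].
move=> u; rewrite addrC -lerBrDr -mulrBl.
set p := pretest_shift t u.
have wE : pretest_window L2 t u - pretest_window L1 t u =
    (Phi (L2 - p) - Phi (L1 - p)) + (Phi (- L1 - p) - Phi (- L2 - p)).
  by rewrite /pretest_window -/p; ring.
have w1 : 0 <= Phi (L2 - p) - Phi (L1 - p).
  by have /Phi_lipschitz/andP[] : L1 - p <= L2 - p by lra.
have w2 : 0 <= Phi (- L1 - p) - Phi (- L2 - p).
  by have /Phi_lipschitz/andP[] : - L2 - p <= - L1 - p by lra.
(* Off the cube the added term vanishes and monotonicity of the window suffices. *)
have [/forallP u1|] := boolP [forall j, `|u 0 j| <= 1]; last first.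
  rewrite negb_forall => /existsP[j uj].
  rewrite (bigD1 j) //= /box (negbTE uj) mul0r mulr0 mulr_ge0 //.
  by rewrite wE addr_ge0.
rewrite big1 ?mulr1; last by move=> j _; rewrite /box u1.
have vb j : `|u 0 j - t j| <= b j + 1.
  by rewrite (le_trans (ler_normB _ _)) // addrC lerD.
have pM : `|p| <= (\sum_j gamma j * (b j + 1)) / Num.sqrt D.
  rewrite /p /pretest_shift normrM (gtr0_norm (_ : 0 < (Num.sqrt D)^-1)) ?invr_gt0 //.
  rewrite ler_pM2r ?invr_gt0 // (le_trans (ler_norm_sum _ _ _)) //.
  apply: ler_sum => j _; rewrite normrM gtr0_norm ?gam_gt0 // ler_pM2l ?gam_gt0 //.
  rewrite (le_trans (ler_normB _ _)) // lerD //.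
  by rewrite normrM normr_nat; case: (_ < _); rewrite ?mulr1 ?mulr0.
have qd : q <= density t u.
  rewrite /mvn_pdf ler_pM2l; last first.
    by rewrite -(pmulr_lgt0 _ (expR_gt0 (- (\sum_j gamma j * (b j + 1) ^+ 2) / 2))).
  rewrite ler_expR ler_pM2r ?invr_gt0 // lerN2 Vmat_quadratic //.
  rewrite lerBlDr ler_wpDr //; first by rewrite mulr_ge0 ?sqr_ge0 // invr_ge0 ltW.
  apply: ler_sum => j _; rewrite ler_pM2l ?gam_gt0 // !mxE.
  by rewrite -[leLHS]real_normK ?num_real // lerXn2r ?nnegrE // (le_trans _ (vb j)).
rewrite /c; apply: ler_pM => //; try exact: ltW.
  by rewrite mulr_ge0 ?subr_ge0 // ltW.
(* Only the gain at the upper endpoint is kept. *)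
rewrite wE ler_wpDr //.
rewrite [X in _ * X](_ : L2 - L1 = L2 - p - (L1 - p)); last by ring.
move: pM; rewrite ler_norml => /andP[pl pr].
by apply: Phi_increase; rewrite /M; lra.
Qed.

End PretestCoverage.

Lemma bernoulli_le (R : realFieldType) (x : R) n :
  0 <= x -> x <= 1 -> 1 - n%:R * x <= (1 - x) ^+ n.
Proof.
move=> x0 x1; elim: n => [|n IH]; first by rewrite mul0r subr0 expr0.
rewrite exprS -natr1; apply: le_trans (_ : (1 - x) * (1 - n%:R * x) <= _).
  have : 0 <= n%:R * x ^+ 2 by rewrite mulr_ge0 // sqr_ge0.
  by rewrite expr2; nra.
by rewrite ler_wpM2l // subr_ge0.
Qed.

(** * Large half-lengths reach any level below 1, uniformly over the box *)

Section Tail.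
Context {R : realType} {K : nat}.
Local Notation mu := (@lebesgue_measure R).
Variables (s0 : R) (s : 'I_K -> R) (alpha : R).
Hypotheses (s0_gt0 : 0 < s0) (s_gt0 : forall j, 0 < s j).
Local Notation gamma := (gam s0 s).
Local Notation D := (1 + Defs.gnorm s0 s).

(** A deterministic bound valid whichever pretests accept, since each indicator is at most 1. *)
Lemma tauPT_dist_le (tau M x0 : R) (t b x : 'I_K -> R) :
  (forall j, `|t j| <= b j) -> `|x0 - tau| <= M * s0 ->
  (forall j, `|x j - (tau + s0 * t j)| <= M * s j) ->
  `|tauPT s0 s alpha x0 x - tau| <=
    M * s0 + \sum_j gamma j / D * (M * s j + s0 * b j + M * s0).
Proof.
move=> tb hx0 hx; have D0 := gnormS_gt0 s0_gt0 s_gt0.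
rewrite /tauPT addrAC (le_trans (ler_normD _ _)) // lerD //.
rewrite (le_trans (ler_norm_sum _ _ _)) //; apply: ler_sum => j _.
have c0 : 0 < gamma j / D by rewrite divr_gt0 // gam_gt0.
rewrite normrM (normrM (gamma j / D)) (gtr0_norm c0) -mulrA ler_pM2l //.
have xx : `|x j - x0| <= M * s j + s0 * b j + M * s0.
  rewrite (_ : x j - x0 = (x j - (tau + s0 * t j)) + s0 * t j - (x0 - tau)); last by ring.
  rewrite (le_trans (ler_normB _ _)) // lerD //.
  rewrite (le_trans (ler_normD _ _)) // lerD //.
  by rewrite normrM gtr0_norm // ler_pM2l.
apply: le_trans xx; rewrite ler_piMr // normr_nat.
by rewrite lern1 leq_b1.
Qed.

(** By independence, all K+1 observations lie within [M] standard deviations of their means with a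
    probability that depends neither on [tau] nor on [t]; on that event the error is at most [N]. *)
Lemma PT_prob_reaches (b : 'I_K -> R) (p : R) : p < 1 -> (forall j, 0 <= b j) ->
  exists2 L : R, 0 <= L & forall (tau : R) t, (forall j, `|t j| <= b j) ->
    (p%:E <= PT_prob s0 s alpha tau (fun j => s0 * t j)%R L)%E.
Proof.
move=> p1 b0; have D0 := gnormS_gt0 s0_gt0 s_gt0.
have sD0 : 0 < Num.sqrt D by rewrite sqrtr_gt0.
(* [p] may be negative; truncation at 0 gives [y <= 1], as the Bernoulli inequality requires. *)
pose p' := Num.max p 0.
have p'1 : p' < 1 by rewrite gt_max p1 ltr01.
have p'0 : 0 <= p' by rewrite le_max lexx orbT.
(* Each of the K+1 observations may miss its window with probability below [y], a total loss of at
   most [1 - p']. *)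
pose y := (1 - p') / K.+1%:R.
have y0 : 0 < y by rewrite divr_gt0 // subr_gt0.
have y1 : y <= 1.
  by rewrite ler_pdivrMr // mul1r -natr1; have : 0 <= K%:R :> R by []; lra.
have [M M0 HM] : exists2 M : R, 0 <= M & 1 - y < Phi M - Phi (- M).
  by apply: Phi_window_cvg1; lra.
pose N := M * s0 + \sum_j gamma j / D * (M * s j + s0 * b j + M * s0).
have N0 : 0 <= N.
  rewrite addr_ge0 ?mulr_ge0 ?(ltW s0_gt0) //; apply: sumr_ge0 => j _.
  have s00 := ltW s0_gt0; have sj0 := ltW (s_gt0 j); have bj0 := b0 j.
  have gj0 : 0 <= gamma j by apply: ltW; exact: gam_gt0.
  apply: mulr_ge0; first by rewrite divr_ge0 // ltW.
  by apply: addr_ge0; [apply: addr_ge0|]; exact: mulr_ge0.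
(* The error bound [N] expressed in units of [s0 / Num.sqrt D]. *)
exists (N * Num.sqrt D / s0); first by rewrite divr_ge0 ?(ltW s0_gt0) // mulr_ge0.
move=> tau t tb; rewrite /PT_prob.
have -> : N * Num.sqrt D / s0 * (Num.sqrt D)^-1 * s0 = N.
  by field; rewrite !gt_eqF.
(* The term [sd * 0] matches [integral_normal_window] with zero shift. *)
pose g (m sd x : R) := (`|x - m + sd * 0| <= M * sd)%R%:R * normal_pdf m sd x.
have mg m sd : measurable_fun [set: R] (g m sd).
  apply: measurable_funM; last exact: measurable_normal_pdf.
  apply: (measurableT_comp (f := fun c : bool => c%:R : R)) => //.
  apply: measurable_fun_ler => //; apply: measurableT_comp => //.
  by apply: measurable_funD => //; exact: measurable_funB.
have g0 m sd x : 0 <= g m sd x by rewrite mulr_ge0 // normal_pdf_ge0.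
have ig m sd : 0 < sd -> (\int[mu]_x (g m sd x)%:E)%E = (Phi M - Phi (- M))%:E.
  by move=> sd0; rewrite integral_normal_window // !subr0.
have pp : p <= (Phi M - Phi (- M)) ^+ K.+1.
  apply: (@le_trans _ _ p'); first by rewrite le_max lexx.
  apply: (@le_trans _ _ ((1 - y) ^+ K.+1)).
    apply: le_trans (bernoulli_le K.+1 (ltW y0) y1).
    by rewrite /y mulrC divfK ?pnatr_eq0 //; lra.
  by apply: lerXn2r; rewrite ?nnegrE ?subr_ge0 ?(ltW HM) //; move: y1 HM; lra.
apply: (@le_trans _ _ (\int[mu]_x0 intRK (fun x : 'rV[R]_K =>
    (g tau s0 x0 * \prod_j g (tau + s0 * t j) (s j) (x 0 j))%:E))%E).
  rewrite (integral_intRK_prod (f := fun j => g (tau + s0 * t j) (s j))) //.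
  rewrite ig //; under eq_bigr do rewrite ig //.
  by rewrite prodEFin prodr_const card_ord -EFinM -exprS lee_fin.
apply: (le_integral_intRK (w1 := fun x0 x =>
    g tau s0 x0 * \prod_j g (tau + s0 * t j) (s j) (x 0 j))
  (w2 := fun x0 x => (`|tauPT s0 s alpha x0 (fun j => x 0 j) - tau| <= N)%R%:R *
    normal_pdf tau s0 x0 * \prod_j normal_pdf (tau + s0 * t j) (s j) (x 0 j))).
- exact: (rmeasurable_prod (f := fun j => g (tau + s0 * t j) (s j))).
- move=> d T h X mh mX; apply: measurable_funM.
    apply: measurable_funM; last exact: measurable_normal_pdf_comp.
    apply: (measurableT_comp (f := fun c : bool => c%:R : R)) => //.
    apply: measurable_fun_ler => //; apply: measurableT_comp => //.
    by apply: measurable_funB => //; exact: (rmeasurable_tauPT s0 s alpha mh mX).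
  by apply: measurable_prod => j _; exact: measurable_normal_pdf_comp.
- by move=> x0 x; rewrite mulr_ge0 // prodr_ge0.
(* Window indicators are separated from densities; their product is then bounded by the indicator of
   the pretest event. *)
move=> x0 x; rewrite /g big_split /= mulrACA -[leRHS]mulrA.
apply: ler_wpM2r.
  by rewrite mulr_ge0 ?normal_pdf_ge0 // prodr_ge0 // => j _; exact: normal_pdf_ge0.
rewrite mulr0 addr0; case: (leP `|x0 - tau|) => hx0; last by rewrite mul0r.
rewrite mul1r.
have [/forallP hx|] := boolP [forall j, `|x 0 j - (tau + s0 * t j)| <= M * s j].
  rewrite (tauPT_dist_le tb hx0 hx).
  by apply: prodr_ile1 => j _; rewrite ler0n lern1 leq_b1.
rewrite negb_forall => /existsP[j xj].
by rewrite (bigD1 j) //= mulr0 addr0 (negbTE xj) mul0r.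
Qed.

End Tail.

Unset Implicit Arguments.

Theorem theorem8 (R : realType) (K : nat) (s0 : R) (s : 'I_K -> R)
  (alpha zeta : R) (b : 'I_K -> R) :
  (0 < K)%N -> 0 < s0 -> (forall j, 0 < s j) ->
  0 < alpha < 1 -> 0 < zeta < 1 -> (forall j, 0 <= b j) ->
  forall tau : R,
    (* (i) *)
    (forall (t : 'I_K -> R) (L : R), 0 <= L ->
       PT_prob s0 s alpha tau (fun j => s0 * t j) L = rhs_i s0 s alpha t L) /\
    (* (ii) *)
    (let Lh := Lhat s0 s alpha tau b zeta in
     h_cov s0 s alpha tau b Lh = (1 - zeta)%:E /\
     (forall L, 0 <= L -> h_cov s0 s alpha tau b L = (1 - zeta)%:E -> L = Lh) /\
     (forall L, 0 <= L ->
        ((1 - zeta)%:E <= h_cov s0 s alpha tau b L)%E <-> Lh <= L)).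
Proof.
move=> _ s0_gt0 s_gt0 _ /andP[z0 z1] b0 tau; split.
  by move=> t L L0; exact: PT_prob_mvn.
pose B := [set Delta : 'I_K -> R | forall j, `|Delta j / s0| <= b j].
have rhsE Delta L : 0 <= L -> PT_prob s0 s alpha tau Delta L =
    rhs_i s0 s alpha (fun j => Delta j / s0) L.
  move=> L0; rewrite -(PT_prob_mvn s0_gt0 s_gt0 alpha tau _ L0).
  have {1}-> : Delta = (fun j => s0 * (Delta j / s0)) by
    apply/funext => j; rewrite mulrC divfK // gt_eqF.
  by [].
have B_nonempty : B !=set0 by exists (fun=> 0) => j; rewrite mul0r normr0.
have C_ge0 : 0 <= normal_peak 1 *+ 2 :> R by rewrite mulrn_wge0 // normal_peak_ge0.
have p_gt0 : 0 < 1 - zeta by rewrite subr_gt0.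
pose P := PT_prob s0 s alpha tau.
have P_at0 Delta : B Delta -> P Delta 0 = 0%E.
  by move=> _; rewrite /P rhsE // rhs_i_at0.
have P_lipschitz Delta L1 L2 : B Delta -> 0 <= L1 -> L1 <= L2 ->
    (P Delta L2 <= P Delta L1 + (normal_peak 1 *+ 2 * (L2 - L1))%:E)%E.
  move=> _ L10 L12; rewrite /P !rhsE //; last exact: le_trans L12.
  exact: rhs_i_lipschitz.
have P_increase L1 L2 : 0 <= L1 -> L1 < L2 ->
    exists2 e : R, 0 < e & forall Delta, B Delta -> (P Delta L1 + e%:E <= P Delta L2)%E.
  move=> L10 L12; have [e e0 He] := rhs_i_increase alpha s0_gt0 s_gt0 b L10 L12.
  exists e => // Delta BD; rewrite /P !rhsE //; last by rewrite (le_trans L10) // ltW.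
  exact: He.
have P_reaches : exists2 L, 0 <= L & forall Delta, B Delta -> ((1 - zeta)%:E <= P Delta L)%E.
  have p1 : 1 - zeta < 1 by lra.
  have [L L0 HL] := PT_prob_reaches alpha s0_gt0 s_gt0 p1 b0.
  exists L => // Delta BD; apply: le_trans (HL tau _ BD) _.
  by rewrite /P PT_prob_mvn // rhsE.
move=> Lh; split; [|split].
(* [h_cov] and [Lhat] unfold to the infimum [h] and to [inf A] of the abstract setting. *)
- exact: (infcov_inf B_nonempty C_ge0 p_gt0 P_at0 P_lipschitz P_increase P_reaches).
- exact: (infcov_unique B_nonempty C_ge0 p_gt0 P_at0 P_lipschitz P_increase P_reaches).
- exact: (infcov_geP B_nonempty C_ge0 p_gt0 P_at0 P_lipschitz P_increase P_reaches).
Qed.
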